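(* Let $G$ be a simple graph. If $G$ is $\ell$-resilient, then $\delta(G)\ge \ell+1$, where $\delta(G)$ is the minimum degree of $G$.
   Context: Zero forcing color change rule: a blue vertex $u$ may force (color blue) a white vertex $v$ if $v$ is the only white neighbor of $u$. A leak is a vertex that is not allowed to perform a force. A set $B\subseteq V(G)$ is an $\ell$-leaky forcing set of $G$ if, whenever any $\ell$ vertices of $G$ are chosen to be leaks (after $B$ has been specified), starting with exactly $B$ blue (all others white) and iteratively applying the color change rule, with leaks not allowed to force, eventually colors all of $V(G)$ blue. $\mathrm{Z}_{(\ell)}(G)$ is the minimum size of an $\ell$-leaky forcing set of $G$. The graph $G$ is $\ell$-resilient if $\mathrm{Z}_{(0)}(G)=\mathrm{Z}_{(\ell)}(G)$.
   Formalization: The graph is assumed nonempty and without isolated vertices; otherwise the claim fails: the one-vertex graph has Z_(0)=Z_(1)=1, so it is 0- and 1-resilient, but its minimum degree is 0. *)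

(* Defs.v *)
From mathcomp Require Import all_boot.

Set Implicit Arguments.
Unset Strict Implicit.
Unset Printing Implicit Defensive.

Section LeakyForcing.

(* A finite simple graph is a symmetric irreflexive adjacency relation [e];
   those two properties are hypotheses of the theorems, not of the
   definitions. *)
Variables (V : finType) (e : rel V).

Definition neighbors (x : V) : {set V} := [set y | e x y].

Definition degree (x : V) : nat := #|neighbors x|.

(* Degrees of a simple graph are smaller than #|V|, so the default value of
   the iterated minimum is only ever reached on the null graph. *)
Definition min_degree : nat := \big[minn/#|V|]_(x : V) degree x.

(* With B the set of blue vertices, u may force v. *)
Definition may_force (B : {set V}) (u v : V) : bool :=
  (u \in B) && (neighbors u :\: B == [set v]).

(* C is obtained from B by a single force, performed by a vertex that is not
   in the set L of leaks. *)
Definition force_step (L : {set V}) : rel {set V} := fun B C =>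
  [exists u, exists v, [&& u \notin L, may_force B u v & C == v |: B]].

Definition forces_all (L B : {set V}) : bool :=
  connect (force_step L) B [set: V].

Definition leaky_forcing_set (l : nat) (B : {set V}) : bool :=
  [forall L : {set V}, (#|L| == l) ==> forces_all L B].

Lemma leaky_forcing_setT (l : nat) : leaky_forcing_set l [set: V].
Proof. by apply/forallP => L; apply/implyP => _; apply: connect0. Qed.

(* By [leaky_forcing_setT], the minimum ranges over a nonempty family. *)
Definition leaky_number (l : nat) : nat :=
  #|[arg min_(B < [set: V] | leaky_forcing_set l B) #|B|]|.

Definition resilient (l : nat) : Prop := leaky_number 0 = leaky_number l.

End LeakyForcing.

(* Main.v *)
Require Import Defs.
From mathcomp Require Import all_boot.

(**
  Suppose some vertex v has degree at most l, and let B be a minimum l-leaky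
  forcing set. Making all neighbors of v leaks shows that v is in B.
  Moreover B forces the whole graph even when all of N[v] leaks. Otherwise let D
  be the set at which this process stops. Since N(v) alone is an admissible set
  of leaks, v can force some neighbor w of v from D; as w is white, D is also a
  stopping point for the admissible set of leaks N[v] \ {w}, a contradiction.
  A process in which N[v] is inactive does not see the color of v, so B \ {v}
  forces everything but v, which is finally forced by any of its neighbors.
  Hence B \ {v} is a zero forcing set smaller than B.
*)

Section Stalled.

Set Implicit Arguments.
Unset Strict Implicit.
Unset Printing Implicit Defensive.

Variables (V : finType) (e : rel V).

(** [C] need not be reachable from any starting set. For [L] empty and [C] not full, the complement
    of [C] is a fort. *)
Definition stalled (L C : {set V}) : Prop :=
  forall u x, u \notin L -> ~~ may_force e C u x.

Lemma stalledS (L L' C : {set V}) : L \subset L' -> stalled L C -> stalled L' C.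
Proof.
move=> sLL' stC u x uL'; apply: stC.
by apply: contraNN uL'; apply: (subsetP sLL').
Qed.

Lemma may_forceS (A C : {set V}) u x :
  A \subset C -> x \notin C -> may_force e A u x -> may_force e C u x.
Proof.
move=> sAC xC /andP[uA /eqP NuA]; rewrite /may_force (subsetP sAC _ uA) /=.
rewrite eqEsubset -{1}NuA setDS //= sub1set inE xC /=.
by move/setP/(_ x): NuA; rewrite !inE eqxx => /andP[].
Qed.

(** This removes the order of forces from the argument. By [may_forceS], a sequence of forces from
    [B] never leaves a stalled superset of [B]; conversely, forcing greedily shrinks the white set
    until it stalls. *)
Lemma forces_allP (L B : {set V}) :
  forces_all e L B <->
  (forall C : {set V}, B \subset C -> stalled L C -> C = [set: V]).
Proof.
split=> [/connectP[p pathp lastp] C sBC stC | closedB].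
  apply/eqP; rewrite -subTset {}lastp.
  elim: p B sBC pathp => //= A p IHp B sBC /andP[stepBA]; apply: IHp.
  have /existsP[u /existsP[x /and3P[uL forceux /eqP->]]] := stepBA.
  rewrite subUset sBC sub1set andbT; apply: contraT => xC.
  by have := stC u x uL; rewrite (may_forceS sBC).
have [n] := ubnP #|~: B|; elim: n B closedB => // n IHn B closedB ltBn.
have [[u [x [uL fux]]] | stB] : (exists u x, u \notin L /\ may_force e B u x)
                                 \/ stalled L B.
  case: (boolP [exists u, exists x, (u \notin L) && may_force e B u x]).
    by case/existsP=> u /existsP[x /andP[uL fux]]; left; exists u, x.
  move=> noforce; right=> u x uL; apply: contraNN noforce => fux.
  by apply/existsP; exists u; apply/existsP; exists x; rewrite uL.
- have xB : x \notin B.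
    by case/andP: fux => _ /eqP/setP/(_ x); rewrite !inE eqxx => /andP[].
  have stepB : force_step e L B (x |: B).
    by apply/existsP; exists u; apply/existsP; exists x; rewrite uL fux /=.
  apply: connect_trans (connect1 stepB) _; apply: IHn => [C sxBC|].
    by apply: closedB; apply: subset_trans sxBC; apply: subsetUr.
  rewrite -ltnS; apply: leq_trans ltBn; rewrite ltnS; apply: proper_card.
  by rewrite properE !setCS subsetUr subUset sub1set negb_and xB.
- by rewrite (closedB B (subxx _) stB) /forces_all connect0.
Qed.

(** Fewer than [l] leaks suffice: [L] is padded to exactly [l] vertices, which needs [l <= #|V|],
    and extra leaks keep [C] stalled. *)
Lemma leaky_stalled (l : nat) (B L C : {set V}) :
  leaky_forcing_set e l B -> #|L| <= l <= #|V| -> B \subset C -> stalled L C ->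
  C = [set: V].
Proof.
move=> leakyB /andP[leLl lelV] sBC stC.
have [L' [sLL' cardL']] : exists L' : {set V}, L \subset L' /\ #|L'| = l.
  elim: l leLl lelV {leakyB} => [|l IHl].
    by rewrite leqn0 => /eqP cL _; exists L; rewrite cL.
  rewrite leq_eqVlt => /predU1P[cL _ | ltL ltlV]; first by exists L.
  have [L' [sLL' cardL']] := IHl ltL (ltnW ltlV).
  have /card_gt0P[x] : 0 < #|~: L'| by rewrite cardsCs setCK subn_gt0 cardL'.
  rewrite inE => xL'; exists (x |: L').
  by rewrite cardsU1 xL' cardL'; split=> //; apply: subset_trans (subsetUr _ _).
move/forallP/(_ L')/implyP: leakyB; rewrite cardL' eqxx => /(_ isT).
by move/forces_allP; apply => //; apply: stalledS stC.
Qed.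

Lemma leaky_forcing_set0 (B : {set V}) :
  (forall C : {set V}, B \subset C -> stalled set0 C -> C = [set: V]) ->
  leaky_forcing_set e 0 B.
Proof.
move=> closedB; apply/forallP=> L; apply/implyP; rewrite cards_eq0 => /eqP->.
exact/forces_allP.
Qed.

Lemma leaky_numberP (l : nat) :
  exists2 B : {set V}, leaky_forcing_set e l B & leaky_number e l = #|B|.
Proof.
rewrite /leaky_number; case: arg_minnP => [|B leakyB _]; last by exists B.
exact: leaky_forcing_setT.
Qed.

Lemma leaky_number_le (l : nat) (B : {set V}) :
  leaky_forcing_set e l B -> leaky_number e l <= #|B|.
Proof.
rewrite /leaky_number; case: arg_minnP => [|A _ minA]; last exact: minA.
exact: leaky_forcing_setT.
Qed.

(** No set of [l] leaks exists, so the empty set qualifies vacuously. *)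
Lemma leaky_number_gt_card (l : nat) : #|V| < l -> leaky_number e l = 0.
Proof.
move=> ltVl; apply/eqP; rewrite -leqn0 -(cards0 V); apply: leaky_number_le.
apply/forallP=> L; apply/implyP=> /eqP cardL.
by have := max_card L; rewrite cardL leqNgt ltVl.
Qed.

Lemma leaky_number0_gt0 :
  0 < #|V| -> (forall x, exists y, e x y) -> 0 < leaky_number e 0.
Proof.
move=> /card_gt0P[v _] no_isolated; have [B leakyB ->] := leaky_numberP 0.
rewrite card_gt0; apply: contraTneq leakyB => ->; apply/negP => leaky0.
have st0 : stalled set0 set0 by move=> u x _; rewrite /may_force inE.
have := leaky_stalled leaky0 _ (subxx _) st0.
by rewrite cards0 leq0n => /(_ isT)/setP/(_ v); rewrite !inE.
Qed.

End Stalled.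

Section LowDegreeVertex.

Set Implicit Arguments.
Unset Strict Implicit.
Unset Printing Implicit Defensive.

Variables (V : finType) (e : rel V) (l : nat) (B : {set V}) (v : V).
Hypotheses (e_sym : symmetric e) (e_irrefl : irreflexive e).
Hypotheses (leV : l <= #|V|) (deg_v : degree e v <= l).
Hypothesis (leakyB : leaky_forcing_set e l B).

(** Otherwise [B] lies in the complement of [v], where the only possible forces are on [v] by its
    neighbors, all of them leaks. *)
Lemma low_degree_in_leaky : v \in B.
Proof.
apply: contraT => vB.
have /setP/(_ v) : ~: [set v] = [set: V]; last by rewrite !inE eqxx.
apply: (leaky_stalled leakyB (L := neighbors e v)).
- by rewrite leV andbT.
- by rewrite subsetC sub1set inE.
move=> u x uNv; apply/negP => /andP[_ /eqP/setP Nu].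
move: (Nu x) (Nu v); rewrite !inE eqxx negbK => /andP[/eqP-> euv].
by move: uNv; rewrite inE e_sym euv.
Qed.

Lemma closed_neighborhood_leaks (D : {set V}) :
  B \subset D -> stalled e (v |: neighbors e v) D -> D = [set: V].
Proof.
move=> sBD stD.
case: (boolP [exists w, may_force e D v w]) => [/existsP[w fvw] | noforce].
  have [evw wD] : e v w /\ w \notin D.
    by case/andP: fvw => _ /eqP/setP/(_ w); rewrite !inE eqxx => /andP[].
  have wNv : w \in v |: neighbors e v by rewrite !inE evw orbT.
  apply: (leaky_stalled leakyB (L := (v |: neighbors e v) :\ w)) => //.
    (* The closed neighborhood has [degree e v + 1] vertices; dropping [w] brings it back within the
       budget [l]. *)
    rewrite leV andbT; apply: leq_trans deg_v; rewrite -ltnS.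
    have := cardsD1 w (v |: neighbors e v); rewrite wNv add1n => <-.
    by rewrite cardsU1 inE e_irrefl.
  move=> u x; rewrite in_setD1 negb_and negbK => /orP[/eqP-> | uL].
    by rewrite /may_force (negbTE wD).
  exact: stD.
apply: (leaky_stalled leakyB (L := neighbors e v)) => //.
  by rewrite leV andbT.
move=> u x uNv; have [-> | neq_uv] := eqVneq u v.
  by apply: contraNN noforce => fvx; apply/existsP; exists x.
by apply: stD; rewrite in_setU1 negb_or neq_uv.
Qed.

Lemma zero_forcing_setD1 : (exists w, e v w) -> leaky_forcing_set e 0 (B :\ v).
Proof.
case=> w evw; apply: leaky_forcing_set0 => C sBC stC.
have vC_full : v |: C = [set: V].
  apply: closed_neighborhood_leaks; first by rewrite -subDset.
  move=> u x; rewrite !inE negb_or => /andP[neq_uv not_evu].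
  (* Such a [u] is not adjacent to [v], so recoloring [v] leaves its white neighbors unchanged. *)
  have NuE : neighbors e u :\: (v |: C) = neighbors e u :\: C.
    apply/setP=> y; rewrite !inE; have [-> | //] := eqVneq y v.
    by rewrite e_sym (negbTE not_evu) !andbF.
  have := stC u x; rewrite inE => /(_ isT).
  by rewrite /may_force in_setU1 (negbTE neq_uv) NuE.
case: (boolP (v \in C)) => vC.
  by rewrite -vC_full; apply/esym/setUidPr; rewrite sub1set.
have inC y : (y \in C) = (y != v).
  have /setP/(_ y) := vC_full; rewrite !inE; have [-> _ | //] := eqVneq y v.
  exact: negbTE.
(* Here only [v] is white, so its neighbor [w] could force it, although [C] is stalled. *)
have := stC w v; rewrite inE => /(_ isT)/negP[].
rewrite /may_force inC; apply/andP; split.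
  by apply: contraTneq evw => ->; rewrite e_irrefl.
apply/eqP/setP=> y; rewrite !inE inC negbK.
by have [-> | //] := eqVneq y v; rewrite e_sym.
Qed.

End LowDegreeVertex.

(* Graphs with an isolated vertex are excluded: the one-vertex graph has
   minimum degree 0 and is l-resilient for l = 0 and l = 1. *)
Theorem proposition3p3 (V : finType) (e : rel V)
    (e_sym : symmetric e) (e_irrefl : irreflexive e)
    (V_nonempty : 0 < #|V|)
    (no_isolated : forall x : V, exists y : V, e x y)
    (l : nat) :
  resilient e l -> l.+1 <= min_degree e.
Proof.
move=> res.
(* For larger [l] the [l]-leaky number is 0 while the zero forcing number is positive. *)
have leV : l <= #|V|.
  rewrite leqNgt; apply/negP => /(leaky_number_gt_card e) Zl0.
  by have := leaky_number0_gt0 V_nonempty no_isolated; rewrite res Zl0.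
have deg_gt v : l < degree e v.
  rewrite ltnNge; apply/negP => deg_v; have [B leakyB cardB] := leaky_numberP e l.
  have vB := low_degree_in_leaky e_sym leV deg_v leakyB.
  have := leaky_number_le (zero_forcing_setD1 e_sym e_irrefl leV deg_v leakyB
                             (no_isolated v)).
  by rewrite res cardB (cardsD1 v B) vB ltnn.
have /card_gt0P[v0 _] := V_nonempty.
rewrite /min_degree; elim/big_ind: _ => [|m n ltm ltn|v _].
(* The default value [#|V|] of the minimum must exceed [l] too; the degree of any vertex lies in
   between. *)
- exact: leq_trans (deg_gt v0) (max_card _).
- by rewrite leq_min ltm.
- exact: deg_gt.
Qed.
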